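(* For every operator ideal $\mathcal{I}$, $$\mathcal{I}^{inj}\circ\mathcal{P}=(\mathcal{I}\circ\mathcal{P})^{inj}.$$ In particular, the polynomial hyper-ideal $\mathcal{I}^{inj}\circ\mathcal{P}$ is injective.
   Context: All Banach spaces are over $\mathbb{K}=\mathbb{R}$ or $\mathbb{C}$. For Banach spaces $E,F$ and $m\in\mathbb{N}$, $\mathcal{L}(E;F)$ is the space of bounded linear operators and $\mathcal{P}(^mE;F)$ the space of continuous $m$-homogeneous polynomials from $E$ to $F$; $\mathcal{P}$ denotes the class of all continuous homogeneous polynomials between Banach spaces. Polynomials of finite type are the finite sums $x\mapsto\sum_i \varphi_i(x)^m y_i$ with $\varphi_i\in E^*$, $y_i\in F$. An operator ideal (in the sense of Pietsch) is a subclass $\mathcal{I}$ of the class of bounded linear operators between Banach spaces such that each component $\mathcal{I}(E;F)=\mathcal{L}(E;F)\cap\mathcal{I}$ is a linear subspace of $\mathcal{L}(E;F)$ containing the finite rank operators, and $t\circ v\circ u\in\mathcal{I}(E;H)$ whenever $t\in\mathcal{L}(G;H)$, $v\in\mathcal{I}(F;G)$, $u\in\mathcal{L}(E;F)$. A polynomial ideal is a class $\mathcal{Q}$ of continuous homogeneous polynomials between Banach spaces such that each component $\mathcal{Q}(^mE;F):=\mathcal{P}(^mE;F)\cap\mathcal{Q}$ is a linear subspace of $\mathcal{P}(^mE;F)$ containing the polynomials of finite type, and $t\circ P\circ u\in\mathcal{Q}(^mE;H)$ whenever $t\in\mathcal{L}(G;H)$, $P\in\mathcal{Q}(^mF;G)$,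 $u\in\mathcal{L}(E;F)$. It is a polynomial hyper-ideal if moreover $t\circ P\circ Q\in\mathcal{Q}(^{mn}E;H)$ whenever $t\in\mathcal{L}(G;H)$, $P\in\mathcal{Q}(^mF;G)$, $Q\in\mathcal{P}(^nE;F)$. Composition ideal: $P\in\mathcal{P}(^mE;F)$ belongs to $\mathcal{I}\circ\mathcal{P}(^mE;F)$ if there are a Banach space $G$, a polynomial $Q\in\mathcal{P}(^mE;G)$ and an operator $u\in\mathcal{I}(G;F)$ such that $P=u\circ Q$. It is well known that $\mathcal{I}\circ\mathcal{P}$ is a polynomial hyper-ideal. A metric injection is a linear operator $j\colon F\to G$ with $\|j(y)\|=\|y\|$ for all $y\in F$. A polynomial ideal (or hyper-ideal) $\mathcal{Q}$ is injective if $P\in\mathcal{Q}(^mE;F)$ whenever $P\in\mathcal{P}(^mE;F)$ and $j\colon F\to G$ is a metric injection with $j\circ P\in\mathcal{Q}(^mE;G)$. Canonical metric injection: $I_F\colon F\to\ell_\infty(B_{F^*})$, $I_F(y)=(\varphi(y))_{\varphi\in B_{F^*}}$, where $B_{F^*}$ is the closed unit ball of the dual $F^*$ and $\ell_\infty(B_{F^*})$ is the space of bounded scalar functions on $B_{F^*}$ with the sup norm. Injective hulls: for a polynomial ideal $\mathcal{Q}$, $\mathcal{Q}^{inj}(^mE;F)=\{P\in\mathcal{P}(^mE;F): I_F\circ P\in\mathcal{Q}(^mE;\ell_\infty(B_{F^*}))\}$; for an operator ideal $\mathcal{I}$, $\mathcal{I}^{inj}(E;F)=\{u\in\mathcal{L}(E;F):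 I_F\circ u\in\mathcal{I}(E;\ell_\infty(B_{F^*}))\}$. *)

(* Defs.v *)
From HB Require Import structures.
From mathcomp Require Import all_boot all_order all_algebra.
From mathcomp Require Import all_classical all_reals topology normedtype.
From mathcomp Require Import complex.

Set Implicit Arguments.
Unset Strict Implicit.
Unset Printing Implicit Defensive.

Import Order.TTheory GRing.Theory Num.Theory.
Import numFieldNormedType.Exports.

Local Open Scope classical_set_scope.
Local Open Scope ring_scope.

Variant scalar_kind := RealScalars | ComplexScalars.

Definition scalar_field (R : realType) (k : scalar_kind) : numFieldType :=
  match k with
  | RealScalars => R
  | ComplexScalars => R[i]
  end.

Section ScalarTheory.
Variable R : realType.

Lemma scalar_supremums k (A : set (scalar_field R k)) :
  A !=set0 -> (forall x, A x -> 0 <= x) -> ubound A !=set0 ->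
  supremums A !=set0.
Proof.
case: k A => /= A A0 Age0 [M AM].
  exists (sup A); split.
    by apply: sup_upper_bound; split => //; exists M.
  by move=> y Ay; apply: ge_sup.
have Arect x : A x -> x = (complex.Re x)%:C%C.
  by move=> /Age0 /ger0_real /RRe_real.
pose B : set R := [set complex.Re x | x in A].
have B0 : B !=set0 by case: A0 => x Ax; exists (complex.Re x), x.
have leRe (x y : R[i]) : x <= y -> complex.Re x <= complex.Re y.
  by rewrite lecE => /andP[].
have Bub : has_ubound B by exists (complex.Re M) => _ [x Ax <-]; apply/leRe/AM.
exists (sup B)%:C%C; split.
  move=> x Ax; rewrite (Arect x Ax) lecR; apply: ub_le_sup => //.
  by exists x.
move=> y Ay.
have [x Ax] := A0.
have Imy : complex.Im y = 0.
  move: (Ay _ Ax); rewrite lecE => /andP[/eqP -> _].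
  by rewrite (Arect x Ax).
have -> : y = (complex.Re y)%:C%C by case: (y) Imy => a b /= ->.
rewrite lecR; apply: ge_sup => // _ [z Az <-].
by apply/leRe/Ay.
Qed.

Lemma scalar_complete k (F : set_system (scalar_field R k)^o) :
  ProperFilter F -> cauchy F -> cvg F.
Proof.
case: k F => /= F FF FC.
  exact: (@R_complete R).
move/cauchyP : FC => FC.
have absR (e : R[i]) : 0 < e -> 0 < complex.Re e /\ e = (complex.Re e)%:C%C.
  by move=> e0; rewrite RRe_real ?gtr0_real //; move: e0; rewrite ltcE => /andP[].
have Re_cvg (p : R[i] -> R) :
    (forall x y, `|p x - p y|%:C%C <= `|x - y|) -> cvg (p @ F).
  move=> pl; apply: R_complete; apply: cauchy_exP => e e0.
  have e0' : 0 < e%:C%C :> R[i] by rewrite ltcR.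
  have [x Fx] := FC _ e0'; exists (p x).
  change (F (p @^-1` ball (p x) e)).
  apply: filterS Fx => y /=; rewrite -!ball_normE /= => xy.
  by rewrite -ltcR; apply: le_lt_trans xy.
have ReL x y : `|complex.Re x - complex.Re y|%:C%C <= `|x - y| :> R[i].
  by rewrite -raddfB; exact: normc_ge_Re.
have ImL x y : `|complex.Im x - complex.Im y|%:C%C <= `|x - y| :> R[i].
  have -> : complex.Im x - complex.Im y = - (complex.Re ((x - y) * 'i%C)) by rewrite ReiNIm opprK -raddfB.
  rewrite normrN; apply: le_trans (normc_ge_Re _) _.
  rewrite normrM; have -> : `|'i%C : R[i]| = 1 by rewrite normc_def /= expr0n expr1n add0r sqrtr1.
  by rewrite mulr1.
have /cvg_ex[a aF] := Re_cvg _ ReL.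
have /cvg_ex[b bF] := Re_cvg _ ImL.
apply/cvg_ex; exists (a +i* b)%C.
apply/cvgrPdist_lt => /= e /absR[e0 eE].
have e20 : 0 < complex.Re e / 2 by rewrite divr_gt0.
move/cvgrPdist_lt : aF => /(_ _ e20) aF.
move/cvgrPdist_lt : bF => /(_ _ e20) bF.
near=> z.
have za : `|a - complex.Re z| < complex.Re e / 2 by near: z.
have zb : `|b - complex.Im z| < complex.Re e / 2 by near: z.
rewrite eE.
have -> : (a +i* b)%C - z = (a - complex.Re z)%:C%C + 'i%C * (b - complex.Im z)%:C%C.
  by rewrite [LHS]complexE !raddfB.
apply: le_lt_trans (ler_normD _ _) _.
rewrite normrM.
have -> : `|'i%C : R[i]| = 1 by rewrite normc_def /= expr0n expr1n add0r sqrtr1.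
have nC (r : R) : `|r%:C%C : R[i]| = `|r|%:C%C.
  by rewrite normc_def /= expr0n addr0 sqrtr_sqr.
rewrite mul1r !nC -rmorphD ltcR (splitr (complex.Re e)).
exact: ltrD.
Unshelve. all: by end_near. Qed.

End ScalarTheory.

Section BoundedFunctions.
Variables (R : realType) (k : scalar_kind) (T : Type).
Local Notation K := (scalar_field R k).

Definition linfty_pred : {pred T -> K^o} :=
  fun f => `[< exists M : K, forall t, `|f t| <= M >].

Lemma linfty_submod_closed : submod_closed linfty_pred.
Proof.
split; first by apply/asboolP; exists 0 => t; rewrite normr0.
move=> a f g /asboolP[M fM] /asboolP[N gN]; apply/asboolP.
exists (`|a| * M + N) => t.
apply: le_trans (ler_normD _ _) _.
by rewrite lerD// normrM ler_wpM2l.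
Qed.

HB.instance Definition _ :=
  GRing.isSubmodClosed.Build K (T -> K^o) linfty_pred linfty_submod_closed.

Record linfty := Linfty {
  linfty_fun :> T -> K^o;
  linfty_funP : linfty_fun \in linfty_pred }.

HB.instance Definition _ := [isSub for linfty_fun].
HB.instance Definition _ := [Choice of linfty by <:].
HB.instance Definition _ := [SubChoice_isSubLmodule of linfty by <:].

(* A norm over [K] is [K]-valued; for complex scalars the order is the partial
   order of [R[i]], in which the upper bounds of a nonempty set of reals are
   real, so that this least upper bound is the real supremum.
   [supremum 0] is total: it returns 0 on the empty set, which gives the norm
   of the trivial space when [T] is empty. *)
Definition linfty_norm (f : linfty) : K :=
  supremum 0 (range (fun t => `|f t|)).

Lemma linfty_norm_ub (f : linfty) t : `|f t| <= linfty_norm f.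
Proof.
have A0 : range (fun t => `|f t|) !=set0 by exists `|f t|, t.
have [s sP] : supremums (range (fun t => `|f t|)) !=set0.
  apply: scalar_supremums => // [_ [u _ <-] //|].
  by have /asboolP[M fM] := linfty_funP f; exists M => _ [u _ <-].
rewrite /linfty_norm /supremum; case: ifPn => [/eqP fE|_].
  by rewrite fE in A0; case: A0.
case: xgetP => [y _ [yub _]|/(_ s) //]; apply: yub; by exists t.
Qed.

Lemma linfty_norm_le (f : linfty) (M : K) :
  0 <= M -> (forall t, `|f t| <= M) -> linfty_norm f <= M.
Proof.
move=> M0 fM; rewrite /linfty_norm /supremum.
case: ifPn => // /set0P A0.
case: xgetP => [_ -> [_]|_]; last by [].
by apply => _ [t _ <-].
Qed.

Lemma linfty_norm_ge0 (f : linfty) : 0 <= linfty_norm f.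
Proof.
have [[t _]|T0] := pselect (exists t : T, True).
  exact: le_trans (normr_ge0 _) (linfty_norm_ub f t).
rewrite /linfty_norm.
have -> : range (fun t => `|f t|) = set0.
  by apply/seteqP; split => // x [t _ _]; case: T0; exists t.
by rewrite supremum0.
Qed.

Lemma linfty_normD (f g : linfty) :
  linfty_norm (f + g) <= linfty_norm f + linfty_norm g.
Proof.
apply: linfty_norm_le => [|t]; first by rewrite addr_ge0 ?linfty_norm_ge0.
by apply: le_trans (ler_normD _ _) _; rewrite lerD ?linfty_norm_ub.
Qed.

Lemma linfty_normZ_le (a : K) (f : linfty) :
  linfty_norm (a *: f) <= `|a| * linfty_norm f.
Proof.
apply: linfty_norm_le => [|t]; first by rewrite mulr_ge0 ?linfty_norm_ge0.
by rewrite /= normrM ler_wpM2l ?linfty_norm_ub.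
Qed.

Lemma linfty_normZ (a : K) (f : linfty) :
  linfty_norm (a *: f) = `|a| * linfty_norm f.
Proof.
apply/eqP; rewrite eq_le linfty_normZ_le /=.
have [->|a0] := eqVneq a 0; first by rewrite normr0 mul0r linfty_norm_ge0.
rewrite -ler_pdivlMl ?normr_gt0// -normfV.
apply: le_trans (linfty_normZ_le _ _).
by rewrite scalerA mulVf// scale1r.
Qed.

Lemma linfty_norm0_eq0 (f : linfty) : linfty_norm f = 0 -> f = 0.
Proof.
move=> f0; apply/val_inj/funext => t; apply/eqP.
by rewrite -normr_le0 -f0 linfty_norm_ub.
Qed.

HB.instance Definition _ := Lmodule_isNormed.Build K linfty
  linfty_normD linfty_normZ linfty_norm0_eq0.

Lemma linfty_complete (F : set_system linfty) :
  ProperFilter F -> cauchy F -> cvg F.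
Proof.
move=> FF /cauchyP FC.
have evcvg t : cvg ((fun f : linfty => f t) @ F).
  apply: scalar_complete; apply: cauchy_exP => e e0.
  have [f Ff] := FC _ e0; exists (f t).
  change (F ((fun f : linfty => f t) @^-1` ball (f t) e)).
  apply: filterS Ff => g; rewrite -!ball_normE /=; apply: le_lt_trans.
  exact: linfty_norm_ub (f - g) t.
pose l t : K^o := lim ((fun f : linfty => f t) @ F).
have key e (f : linfty) : 0 < e -> F (ball f e) -> forall t, `|f t - l t| <= e.
  move=> e0 Ff t.
  have := evcvg t => /cvgrPdist_lt lt.
  apply/ler_addgt0Pr => d d0.
  have [g [fg gl]] : exists g, ball f e g /\ `|l t - g t| < d.
    have Fl : F [set g : linfty | `|l t - g t| < d] by exact: lt.
    by have [g []] := filter_ex (filterI Ff Fl); exists g.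
  have -> : f t - l t = (f t - g t) - (l t - g t) by rewrite opprB addrA subrK.
  apply: le_trans (ler_normB _ _) _; apply: lerD; last exact: ltW.
  move: fg; rewrite -ball_normE /= => fg; apply: le_trans (ltW fg).
  exact: linfty_norm_ub (f - g) t.
have lP : l \in linfty_pred.
  apply/asboolP; have [f Ff] := FC 1 ltr01.
  exists (1 + linfty_norm f) => t.
  have -> : l t = - (f t - l t) + f t by rewrite opprB subrK.
  apply: le_trans (ler_normD _ _) _; rewrite normrN.
  by rewrite lerD ?linfty_norm_ub// key.
apply/cvg_ex; exists (Linfty lP); apply/cvgrPdist_le => /= e e0.
have e20 : 0 < e / 2 by rewrite divr_gt0.
have [f Ff] := FC _ e20.
apply: filterS (Ff) => g; rewrite -ball_normE /= => fg.
have -> : Linfty lP - g = (f - g) - (f - Linfty lP).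
  by rewrite opprB [RHS]addrC addrA subrK.
apply: le_trans (ler_normB _ _) _; rewrite (splitr e).
apply: lerD; first exact: ltW.
by apply: linfty_norm_le; [exact: ltW|exact: key].
Qed.

HB.instance Definition _ := Uniform_isComplete.Build linfty linfty_complete.

End BoundedFunctions.

Section IdealsOfPolynomials.
Variables (R : realType) (k : scalar_kind).
Local Notation K := (scalar_field R k).
Local Notation banach := (completeNormedModType K).

Definition bounded_operator (E F : normedModType K) (u : E -> F) : Prop :=
  linear u /\ exists M : K, forall x, `|u x| <= M * `|x|.

Definition multilinear (m : nat) (E F : normedModType K)
    (A : ('I_m -> E) -> F) : Prop :=
  forall (v : 'I_m -> E) (i : 'I_m), linear (fun x : E => A (dfwith v i x)).

(* The generating multilinear map [A] need not be symmetric, and continuity is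
   required of [P] itself. *)
Definition homogeneous_polynomial (m : nat) (E F : normedModType K)
    (P : E -> F) : Prop :=
  (exists A : ('I_m -> E) -> F, multilinear A /\ forall x, P x = A (fun=> x)) /\
  continuous P.

Definition finite_rank (E F : normedModType K) (u : E -> F) : Prop :=
  bounded_operator u /\
  exists (n : nat) (y : 'I_n -> F),
    forall x, exists c : 'I_n -> K, u x = \sum_(i < n) c i *: y i.

Definition finite_type (m : nat) (E F : normedModType K) (P : E -> F) : Prop :=
  exists (n : nat) (phi : 'I_n -> E -> K^o) (y : 'I_n -> F),
    (forall i, bounded_operator (phi i)) /\
    forall x, P x = \sum_(i < n) (phi i x) ^+ m *: y i.

Definition linear_subspace (E F : normedModType K) (S : set (E -> F)) : Prop :=
  S (fun=> 0) /\
  forall (a : K) (u v : E -> F), S u -> S v -> S (fun x => a *: u x + v x).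

Definition operator_class := forall E F : banach, set (E -> F).

(* The value at [m], [E], [F] is the component Q(^m E; F). *)
Definition polynomial_class := forall (m : nat) (E F : banach), set (E -> F).

Record operator_ideal (I : operator_class) : Prop := OperatorIdeal {
  operator_ideal_sub : forall (E F : banach) (u : E -> F),
    I E F u -> bounded_operator u;
  operator_ideal_linear : forall E F : banach, linear_subspace (I E F);
  operator_ideal_finite_rank : forall (E F : banach) (u : E -> F),
    finite_rank u -> I E F u;
  operator_ideal_comp : forall (E F G H : banach)
      (t : G -> H) (v : F -> G) (u : E -> F),
    bounded_operator t -> I F G v -> bounded_operator u ->
    I E H (t \o v \o u) }.

(* Degrees are positive: the values of a [polynomial_class] at [m = 0] are
   never constrained. *)
Record polynomial_ideal (Q : polynomial_class) : Prop := PolynomialIdeal {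
  polynomial_ideal_sub : forall (m : nat) (E F : banach) (P : E -> F),
    (0 < m)%N -> Q m E F P -> homogeneous_polynomial m P;
  polynomial_ideal_linear : forall (m : nat) (E F : banach),
    (0 < m)%N -> linear_subspace (Q m E F);
  polynomial_ideal_finite_type : forall (m : nat) (E F : banach) (P : E -> F),
    (0 < m)%N -> finite_type m P -> Q m E F P;
  polynomial_ideal_comp : forall (m : nat) (E F G H : banach)
      (t : G -> H) (P : F -> G) (u : E -> F),
    (0 < m)%N -> bounded_operator t -> Q m F G P -> bounded_operator u ->
    Q m E H (t \o P \o u) }.

Record polynomial_hyper_ideal (Q : polynomial_class) : Prop :=
  PolynomialHyperIdeal {
  hyper_ideal_polynomial_ideal : polynomial_ideal Q;
  hyper_ideal_comp : forall (m n : nat) (E F G H : banach)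
      (t : G -> H) (P : F -> G) (P' : E -> F),
    (0 < m)%N -> (0 < n)%N ->
    bounded_operator t -> Q m F G P -> homogeneous_polynomial n P' ->
    Q (m * n)%N E H (t \o P \o P') }.

Definition composition_ideal (I : operator_class) : polynomial_class :=
  fun m E F P =>
    homogeneous_polynomial m P /\
    exists (G : banach) (Q : E -> G) (u : G -> F),
      [/\ homogeneous_polynomial m Q, I G F u & P = u \o Q].

Definition metric_injection (F G : normedModType K) (j : F -> G) : Prop :=
  linear j /\ forall y, `|j y| = `|y|.

Definition injective_polynomial_class (Q : polynomial_class) : Prop :=
  forall (m : nat) (E F G : banach) (P : E -> F) (j : F -> G),
    (0 < m)%N -> homogeneous_polynomial m P -> metric_injection j ->
    Q m E G (j \o P) -> Q m E F P.

(* The last field says that the operator norm, i.e. the supremum of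
   [`|dual_fun y|] over [`|y| <= 1], is at most 1. *)
Record dual_ball (F : normedModType K) := DualBall {
  dual_fun :> F -> K^o;
  dual_fun_bounded_operator : bounded_operator dual_fun;
  dual_fun_norm : forall y, `|y| <= 1 -> `|dual_fun y| <= 1 }.

Lemma dual_ball_le (F : normedModType K) (phi : dual_ball F) (y : F) :
  `|phi y| <= `|y|.
Proof.
have [phiL _] := dual_fun_bounded_operator phi.
have phiZ (a : K) (z : F) : phi (a *: z) = a * phi z.
  have phi0 : phi 0 = 0 by have := phiL (-1) 0 0; rewrite !scaleN1r !addNr.
  by have := phiL a z 0; rewrite !addr0 phi0 addr0.
have [->|y0] := eqVneq y 0.
  by have := phiZ 0 0; rewrite scale0r mul0r => ->; rewrite !normr0.
have ny0 : 0 < `|y| by rewrite normr_gt0.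
have : `|phi (`|y|^-1 *: y)| <= 1.
  by apply: dual_fun_norm; rewrite normrZ normfV normr_id mulVf// gt_eqF.
by rewrite phiZ normrM normfV normr_id ler_pdivrMl// mulr1.
Qed.

Lemma evaluation_bounded (F : normedModType K) (y : F) :
  (fun phi : dual_ball F => phi y) \in @linfty_pred R k (dual_ball F).
Proof. by apply/asboolP; exists `|y| => phi; exact: dual_ball_le. Qed.

Definition canonical_injection (F : normedModType K) (y : F) :
    linfty R k (dual_ball F) :=
  Linfty (evaluation_bounded y).

Definition operator_injective_hull (I : operator_class) : operator_class :=
  fun E F u =>
    bounded_operator u /\
    I E (linfty R k (dual_ball F)) (canonical_injection (F := F) \o u).

Definition polynomial_injective_hull (Q : polynomial_class) :
    polynomial_class :=
  fun m E F P =>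
    homogeneous_polynomial m P /\
    Q m E (linfty R k (dual_ball F)) (canonical_injection (F := F) \o P).

End IdealsOfPolynomials.

Arguments composition_ideal {R k} I m E F _.
Arguments operator_injective_hull {R k} I E F _.
Arguments polynomial_injective_hull {R k} Q m E F _.

(* Main.v *)
From HB Require Import structures.
Require Import Defs.
From mathcomp Require Import all_boot all_order all_algebra.
From mathcomp Require Import all_classical all_reals topology normedtype.
From mathcomp Require Import complex ring.

(* If [I_F \o P = u \o Q] with [u] in [I], the pullback [{(g, y) | u g = I_F y}]
   is a closed subspace of [G * F]; [P] factors through it as [v \o (Q, P)] with
   [v] the second projection, and [I_F \o v] is [u] composed with the first
   projection, so [v] lies in the injective hull of [I]. Injectivity then
   amounts to factoring [I_F] through [I_G \o j], by extending functionals along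
   [j] with the Hahn-Banach theorem. *)

Set Implicit Arguments.
Unset Strict Implicit.
Unset Printing Implicit Defensive.

Import Order.TTheory GRing.Theory Num.Theory.
Import numFieldNormedType.Exports.

Local Open Scope classical_set_scope.
Local Open Scope ring_scope.

(** * The Hahn-Banach theorem *)

Section LinearGraphs.
Variables (K : fieldType) (V W : lmodType K).

(** A partial linear map is encoded by its graph, a linear subspace of the product. Extension is
    then inclusion, and the natural upper bound of a chain is its union. *)
Definition linear_graph (X : set (V * W)) : Prop :=
  X 0 /\ forall a x y, X x -> X y -> X (a *: x + y).

Lemma linear_graph_extend (X : set (V * W)) (z : V * W) :
  linear_graph X ->
  linear_graph [set y | exists a, exists2 x, X x & y = a *: z + x].
Proof.
move=> [X0 XL]; split; first by exists 0, 0 => //; rewrite scale0r addr0.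
move=> b _ _ [a [x Xx ->]] [a' [x' Xx' ->]].
exists (b * a + a'), (b *: x + x'); first exact: XL.
by rewrite scalerDr scalerA scalerDl addrACA.
Qed.

(* Zorn's lemma on partial linear maps, in the form shared by the Hahn-Banach
   theorem and by the existence of algebraic projections: [D] is the pointwise
   constraint to be preserved, and it is what forces graphs to be functional. *)
Lemma linear_graph_total (D X0 : set (V * W)) :
  linear_graph X0 -> X0 `<=` D ->
  (forall w, (forall a, D (0, a *: w)) -> w = 0) ->
  (forall X x0, linear_graph X -> X `<=` D -> (forall w, ~ X (x0, w)) ->
     exists c, forall a x, X x -> D (a *: (x0, c) + x)) ->
  exists f : V -> W,
    [/\ linear f, forall x, D (x, f x) & forall x w, X0 (x, w) -> f x = w].
Proof.
move=> X0L X0D Dfun Dext.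
pose P X := X = set0 \/ [/\ linear_graph X, X0 `<=` X & X `<=` D].
have [F FP Ftot|X [PX Xmax]] := @Zorn_bigcup _ P.
  have [[Y FY Yn0]|F0] := pselect (exists2 Y, F Y & Y <> set0); last first.
    left; apply/seteqP; split=> // x [Y FY Yx]; apply: F0; exists Y => // Y0.
    by rewrite Y0 in Yx.
  have FP' Z z : F Z -> Z z -> [/\ linear_graph Z, X0 `<=` Z & Z `<=` D].
    by move=> FZ Zz; have [Z0|//] := FP _ FZ; rewrite Z0 in Zz.
  have [YL X0Y YD] : [/\ linear_graph Y, X0 `<=` Y & Y `<=` D].
    by have [] := FP _ FY.
  right; split.
  - split; first by exists Y => //; case: YL.
    move=> a x y [Z FZ Zx] [Z' FZ' Z'y].
    have [ZZ'|Z'Z] := Ftot _ _ FZ FZ'.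
      exists Z' => //; have [[_ L] _ _] := FP' _ _ FZ' Z'y.
      by apply: L => //; apply: ZZ'.
    exists Z => //; have [[_ L] _ _] := FP' _ _ FZ Zx.
    by apply: L => //; apply: Z'Z.
  - by move=> x /X0Y Yx; exists Y.
  - by move=> x [Z FZ Zx]; have [_ _] := FP' _ _ FZ Zx; apply.
have [XL X0X XD] : [/\ linear_graph X, X0 `<=` X & X `<=` D].
  (* A maximal [X] is nonempty, since [X0] is admissible and strictly contains the empty set. *)
  case: PX => // X_0; exfalso; apply: (Xmax X0); last by right; split.
  by rewrite X_0; split => // /(_ 0) X00; apply: X00; case: X0L.
have [X00 XC] := XL.
have Xfun x w w' : X (x, w) -> X (x, w') -> w = w'.
  (* Two values at the same point differ by a vector all of whose multiples are values at 0, which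
     [Dfun] forces to vanish. *)
  move=> Xw Xw'; apply/eqP; rewrite -subr_eq0; apply/eqP/Dfun => a; apply: XD.
  have -> : (0, a *: (w - w')) = a *: ((-1) *: (x, w') + (x, w)) + 0.
    congr (_, _) => /=; rewrite scaleN1r.
      by rewrite addNr scaler0 addr0.
    by rewrite [- w' + w]addrC addr0.
  exact/XC/X00/XC/Xw/Xw'.
have Xtot x : exists w, X (x, w).
  (* At a point without a value, [Dext] supplies one, and the span of [X] and the new pair
     contradicts maximality. *)
  apply: contrapT => /forallNP Xx.
  have [c cD] := Dext _ _ XL XD Xx.
  pose Y : set (V * W) :=
    [set y | exists a, exists2 z, X z & y = a *: (x, c) + z].
  apply: (Xmax Y).
    split=> [z Xz|/(_ (x, c)) YX].
      by exists 0, z; rewrite ?scale0r ?add0r.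
    by apply/Xx/YX; exists 1, 0; rewrite ?scale1r ?addr0.
  right; split; first exact: linear_graph_extend.
    by move=> z /X0X Xz; exists 0, z => //; rewrite scale0r add0r.
  by move=> _ [a [z Xz ->]]; apply: cD.
have /choice[f Xf] := Xtot.
exists f; split => [a x y|x|x w /X0X Xw]; last exact: Xfun Xw.
  by apply: Xfun (Xf _) _; apply: (XC a _ _ (Xf x) (Xf y)).
by apply: XD.
Qed.

End LinearGraphs.

(** The identity of [S] is extended to all of [V] under the constraint that values stay in [S] and
    that 0 is sent only to 0. *)
Lemma linear_projection (K : fieldType) (V : lmodType K) (S : {pred V}) :
  submod_closed S ->
  exists f : V -> V,
    [/\ linear f, forall x, f x \in S & forall x, x \in S -> f x = x].
Proof.
move=> [S0 SL].
have [||||f [fL fS fid]] := @linear_graph_total _ V V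
  [set z | z.2 \in S /\ (z.1 = 0 -> z.2 = 0)] [set z | z.1 \in S /\ z.2 = z.1].
- split; first by split.
  by move=> a x y [xS xE] [yS yE] /=; rewrite xE yE; split => //; apply: SL.
- by move=> z [zS zE]; split; rewrite zE.
- by move=> w /(_ 1) [_]; rewrite scale1r; apply.
(* A new vector [x0] is sent to 0. If [a *: x0 + x.1 = 0] with [a] nonzero, then [x0] is a multiple
   of [x.1] and already has a value. *)
- move=> X x0 [X0 XL] XD Xx0; exists 0 => a x Xx; have [xS x0E] := XD _ Xx.
  split; rewrite /= scaler0 add0r// => /eqP.
  have [->|a0] := eqVneq a 0; first by rewrite scale0r add0r => /eqP.
  rewrite addr_eq0 => /eqP ax0; exfalso; apply: (Xx0 (- a^-1 *: x.2)).
  have -> : x0 = - a^-1 *: x.1.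
    by rewrite scaleNr -scalerN -ax0 scalerA mulVf// scale1r.
  by have := XL (- a^-1) _ _ Xx X0; rewrite addr0.
exists f; split => [//|x|x xS]; first by have [] := fS x.
by apply: fid.
Qed.

(** The constraint is domination by [p]. It is functional because [p 0 = 0] bounds both a value at 0
    and its opposite, and the extension by one dimension is the classical supremum argument. *)
Lemma hahn_banach (R : realType) (V : lmodType R) (p : V -> R)
    (X0 : set (V * R^o)) :
  (forall x y, p (x + y) <= p x + p y) ->
  (forall a x, 0 <= a -> p (a *: x) = a * p x) ->
  linear_graph X0 -> (forall x r, X0 (x, r) -> r <= p x) ->
  exists f : V -> R^o,
    [/\ linear f, forall x, f x <= p x & forall x r, X0 (x, r) -> f x = r].
Proof.
move=> pD pZ X0L X0p.
apply: (@linear_graph_total _ V R^o [set z | z.2 <= p z.1]) => //.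
- by move=> [x r] /X0p.
- move=> w /= wp; have p0 : p 0 = 0 by rewrite -(scale0r 0) pZ// mul0r.
  apply/eqP; rewrite eq_le; have := wp 1; have := wp (-1).
  by rewrite p0 scaleN1r scale1r oppr_le0 => -> ->.
move=> X x0 [X0' XL] Xp _.
(* A value [c] at [x0] must satisfy [r - p (x - x0) <= c <= p (y + x0) - s] for all pairs [(x, r)]
   and [(y, s)] of the graph. [A] collects the lower bounds, [AB] places them below the upper ones,
   and [c] is taken to be [sup A]. *)
pose A : set R := [set r | exists2 z, X z & r = (z.2 : R) - p (z.1 - x0)].
have AB (x y : V) (r s : R) : X (x, r) -> X (y, s) ->
    r - p (x - x0) <= p (y + x0) - s.
  move=> Xx Xy; rewrite lerBlDr addrAC lerBrDr.
  have /Xp/= := XL 1 _ _ Xx Xy; rewrite !scale1r => /le_trans; apply.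
  rewrite [leRHS]addrC; apply: le_trans (pD _ _).
  by rewrite addrACA addNr addr0.
have Asup : has_sup A.
  split; first by eexists; exists 0.
  by exists (p (0 + x0) - 0) => _ [[y s] Xy ->]; apply: AB Xy X0'.
have cl (x : V) (r : R) : X (x, r) -> r - sup A <= p (x - x0).
  move=> Xx; rewrite lerBlDr addrC -lerBlDr; apply: ub_le_sup => //.
    by case: Asup.
  by exists (x, r).
have cr (x : V) (r : R) : X (x, r) -> r + sup A <= p (x + x0).
  move=> Xx; rewrite addrC -lerBrDr; apply: ge_sup; first by case: Asup.
  by move=> _ [[y s] Xy ->]; apply: AB.
exists (sup A) => a [x r] Xx; change (a * sup A + (r : R) <= p (a *: x0 + x)).
have Xa (b : R) : X (b *: x, b * r).
  by have := XL b _ _ Xx X0'; rewrite addr0.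
(* For [a] positive or negative, [cr] or [cl] is applied to the pair divided by [a] or [- a], and
   the result is scaled back by positive homogeneity of [p]. *)
have [a0|a0|<-] := ltgtP 0 a;
  last by rewrite mul0r scale0r !add0r; exact: (Xp _ Xx).
  move: (cr _ _ (Xa a^-1)) => {}cr.
  rewrite -(ler_pM2l a0) -(pZ _ _ (ltW a0)) in cr.
  rewrite mulrDr mulrA mulfV ?gt_eqF// mul1r in cr.
  rewrite scalerDr scalerA mulfV ?gt_eqF// scale1r in cr.
  by rewrite addrC [a *: _ + _]addrC.
have Na0 : 0 < - a by rewrite oppr_gt0.
move: (cl _ _ (Xa (- a)^-1)) => {}cl.
rewrite -(ler_pM2l Na0) -(pZ _ _ (ltW Na0)) in cl.
rewrite mulrBr mulrA mulfV ?gt_eqF// mul1r in cl.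
rewrite scalerBr scalerA mulfV ?gt_eqF// scale1r scaleNr mulNr !opprK in cl.
by rewrite addrC [a *: _ + _]addrC.
Qed.

(** An alias of [V] that carries a real module structure, with scalars restricted from [R[i]] to
    [R]. The parameter [R] ties the alias to its real field. *)
Definition realified (R : realType) (V : Type) : Type := V.

Section Realification.
Variables (R : realType) (V : lmodType R[i]).

HB.instance Definition _ := GRing.Zmodule.copy (realified R V) V.

Let rscale (a : R) (x : realified R V) : realified R V := a%:C%C *: (x : V).

Let rscaleA a b x : rscale a (rscale b x) = rscale (a * b) x.
Proof. by rewrite /rscale scalerA rmorphM. Qed.

Let rscale1 : left_id 1 rscale.
Proof. exact: scale1r. Qed.

Let rscaleDr : right_distributive rscale +%R.
Proof. by move=> a; exact: scalerDr. Qed.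

Let rscaleDl x : {morph rscale^~ x : a b / a + b}.
Proof. by move=> a b; rewrite /rscale rmorphD scalerDl. Qed.

HB.instance Definition _ := GRing.Zmodule_isLmodule.Build R (realified R V)
  rscaleA rscale1 rscaleDr rscaleDl.

End Realification.

Section LinearMaps.
Variables (K : numFieldType) (V W : lmodType K) (f : V -> W).
Hypothesis fL : linear f.

Lemma linear_fun0 : f 0 = 0.
Proof. by have := fL (-1) 0 0; rewrite !scaleN1r !addNr. Qed.

Lemma linear_funD x y : f (x + y) = f x + f y.
Proof. by have := fL 1 x y; rewrite !scale1r. Qed.

Lemma linear_funZ a x : f (a *: x) = a *: f x.
Proof. by have := fL a x 0; rewrite linear_fun0 !addr0. Qed.

Lemma linear_funB x y : f (x - y) = f x - f y.
Proof. by rewrite -scaleN1r linear_funD linear_funZ scaleN1r. Qed.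

End LinearMaps.

(** * Norm-preserving extension of functionals along metric injections *)

Section DualExtension.
Variables (R : realType).

(** Hahn-Banach with the norm as dominating function, starting from the pairs [(j y, f y)].
    Domination at [x] and at [- x] together bounds the absolute value. *)
Lemma real_dual_extension (F G : normedModType R) (j : F -> G) (f : F -> R^o) :
  linear j -> (forall y, `|j y| = `|y|) -> linear f ->
  (forall y, `|f y| <= `|y|) ->
  exists g : G -> R^o,
    [/\ linear g, forall x, `|g x| <= `|x| & forall y, g (j y) = f y].
Proof.
move=> jL jn fL fn.
have [|||//|g [gL gp gj]] := @hahn_banach R G (fun x => `|x|)
  [set z | exists y, z = (j y, f y)].
- exact: ler_normD.
- by move=> a x a0; rewrite normrZ ger0_norm.
- split; first by exists 0; rewrite (linear_fun0 jL) (linear_fun0 fL).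
  by move=> a _ _ [x ->] [y ->]; exists (a *: x + y); rewrite jL fL.
- by move=> x r [y [-> ->]]; rewrite jn (le_trans (ler_norm _)).
exists g; split => // [x|y]; last by apply: gj; exists y.
rewrite ler_norml gp andbT lerNl.
have := gp (- x); rewrite normrN -[- x]sub0r.
by rewrite (linear_funB gL) (linear_fun0 gL) sub0r.
Qed.

(** The real part of [f] is extended as a real functional, and a complex functional is then
    recovered from its real part (the Bohnenblust-Sobczyk argument). *)
Lemma complex_dual_extension (F G : normedModType R[i]) (j : F -> G)
    (f : F -> R[i]^o) :
  linear j -> (forall y, `|j y| = `|y|) -> linear f ->
  (forall y, `|f y| <= `|y|) ->
  exists g : G -> R[i]^o,
    [/\ linear g, forall x, `|g x| <= `|x| & forall y, g (j y) = f y].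
Proof.
move=> jL jn fL fn.
have normE (V : normedModType R[i]) (x : V) : `|x| = (complex.Re `|x|)%:C%C.
  by rewrite RRe_real// ger0_real.
have ReM (a : R) (z : R[i]) : complex.Re (a%:C%C * z) = a * complex.Re z.
  by case: z => b c /=; rewrite mul0r subr0.
have ReD (z w : R[i]) : complex.Re (z + w) = complex.Re z + complex.Re w.
  by case: z w => [b c] [b' c'].
have leRe (z w : R[i]) : z <= w -> complex.Re z <= complex.Re w.
  by rewrite lecE => /andP[].
have [||||h [hL hp hj]] := @hahn_banach R (realified R G)
  (fun x => complex.Re `|x : G|)
  [set z | exists y, z = (j y, complex.Re (f y))].
- by move=> x y; rewrite -ReD; apply/leRe/ler_normD.
- move=> a x a0.
  change (complex.Re `|a%:C%C *: (x : G)| = a * complex.Re `|x : G|).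
  by rewrite normrZ ger0_norm ?ReM// lecR.
- split; first by exists 0; rewrite (linear_fun0 jL) (linear_fun0 fL).
  move=> a _ _ [x ->] [y ->]; exists (a%:C%C *: x + y).
  by rewrite jL fL ReD ReM.
- move=> x r [y [-> ->]]; rewrite jn; apply: le_trans (leRe _ _ (fn y)).
  by rewrite -lecR -normE (le_trans _ (normc_ge_Re _))// lecR ler_norm.
pose H (x : G) : R := h x.
have hD (x y : G) : H (x + y) = H x + H y.
  by have := hL 1 x y; rewrite !scale1r.
have h0 : H 0 = 0 by have := hL (-1) 0 0; rewrite /H !scaleN1r !addNr.
have hZ (a : R) (x : G) : H (a%:C%C *: x) = a * H x.
  by have := hL a x 0; rewrite -[h 0]/(H 0) h0 !addr0.
(* This is [H x - i H (i x)], the only complex linear functional with real part [H]. *)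
pose g (x : G) : R[i]^o := (H x +i* - H ('i%C *: x))%C.
have gD (x y : G) : g (x + y) = g x + g y.
  by rewrite /g scalerDr !hD opprD.
have gZ (a : R[i]) (x : G) : g (a *: x) = a * g x.
  have hC (b c : R) (y : G) :
      H ((b +i* c)%C *: y) = b * H y + c * H ('i%C *: y).
    rewrite -hZ -hZ -hD scalerA -scalerDl; congr (H (_ *: _)).
    by apply/eqP; rewrite eq_complex /=; apply/andP; split; apply/eqP; ring.
  case: a => b c; rewrite /g scalerA.
  have -> : ('i * (b +i* c) = (- c) +i* b)%C.
    by apply/eqP; rewrite eq_complex /=; apply/andP; split; apply/eqP; ring.
  rewrite (hC b c) (hC (- c) b); apply/eqP; rewrite eq_complex /=; apply/andP.
  by split; apply/eqP; ring.
exists g; split=> [a x y|x|y]; first by rewrite gD gZ.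
  have [->|gx0] := eqVneq (g x) 0; first by rewrite normr0.
  (* Rotating [x] by the unimodular [t] makes [g (t *: x)] real and equal to the modulus of [g x],
     so it is the value of [H] at [t *: x], which the norm of [x] dominates. *)
  pose t := `|g x| / g x.
  have t1 : `|t| = 1 by rewrite normrM normfV normr_id mulfV// normr_eq0.
  have gt : g (t *: x) = `|g x| by rewrite gZ mulfVK.
  rewrite [leLHS]normE [leRHS]normE lecR -gt.
  by have := hp (t *: x); rewrite normrZ t1 mul1r.
have fZ a : f (a *: y) = a * f y by rewrite (linear_funZ fL).
have Hj z : H (j z) = complex.Re (f z) by apply: hj; exists z.
(* On the range of [j], [g] is rebuilt from the real parts of [f y] and [i f y], and the latter is
   minus the imaginary part of [f y]. *)
rewrite /g -(linear_funZ jL) !Hj.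
by rewrite fZ mulrC ReiNIm opprK; case: (f y).
Qed.

Lemma dual_extension (k : scalar_kind)
    (F G : normedModType (scalar_field R k)) (j : F -> G) (phi : dual_ball F) :
  metric_injection j ->
  exists psi : dual_ball G, forall y, psi (j y) = phi y.
Proof.
move=> [jL jn].
have [phiL _] := dual_fun_bounded_operator phi.
have [g [gL gn gj]] : exists g : G -> (scalar_field R k)^o,
    [/\ linear g, forall x, `|g x| <= `|x| & forall y, g (j y) = phi y].
  have phin := dual_ball_le phi.
  (* Fixing [k] makes [scalar_field R k] reduce to [R] or [R[i]], to which the two previous lemmas
     apply. *)
  case: k F G j jL jn phi phiL phin => F G j jL jn phi phiL phin.
    exact: real_dual_extension.
  exact: complex_dual_extension.
have gb : bounded_operator g by split => //; exists 1 => x; rewrite mul1r.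
have g1 y : `|y| <= 1 -> `|g y| <= 1 by exact: le_trans.
by exists (DualBall gb g1).
Qed.

End DualExtension.

(** * Products and closed subspaces of Banach spaces *)

Lemma contraction_cauchy (K : numFieldType) (V W : normedModType K) (f : V -> W)
    (F : set_system V) :
  (forall x y, `|f x - f y| <= `|x - y|) -> ProperFilter F ->
  cauchy F -> cauchy (f @ F).
Proof.
move=> fl FF /cauchyP FC; apply: cauchy_exP => e e0.
have [x Fx] := FC _ e0; exists (f x).
change (F (f @^-1` ball (f x) e)).
apply: filterS Fx => y; rewrite -!ball_normE /=; exact: le_lt_trans.
Qed.

Section ProductComplete.
Variables (K : numFieldType) (V W : completeNormedModType K).

HB.instance Definition _ := Pointed.on (V * W)%type.

Lemma prod_complete (F : set_system (V * W)%type) :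
  ProperFilter F -> cauchy F -> cvg F.
Proof.
move=> FF FC.
have /cauchy_cvg/cvg_ex[a aF] : cauchy (fst @ F).
  apply: (@contraction_cauchy _ (V * W)%type V) => // x y.
  by rewrite prod_normE comparable_le_max ?real_comparable ?normr_real// lexx.
have /cauchy_cvg/cvg_ex[b bF] : cauchy (snd @ F).
  apply: (@contraction_cauchy _ (V * W)%type W) => // x y.
  by rewrite prod_normE comparable_le_max ?real_comparable ?normr_real// lexx orbT.
apply: (cvgP (a, b)).
(* Written as its own image under the pairing of coordinates, [F] converges because both of its
   projections do. *)
have -> : F = (fun x => (x.1, x.2)) @ F.
  rewrite predeqE => A; change (F A <-> F [set x | A (x.1, x.2)]).
  by split; apply: filterS => -[].
exact: cvg_pair aF bF.
Qed.

HB.instance Definition _ := Uniform_isComplete.Build (V * W)%type prod_complete.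

End ProductComplete.

(** * Closed subspaces as Banach spaces *)

Section ClosedSubspaces.
Variables (K : numFieldType) (V : completeNormedModType K).

Record closed_subspace := ClosedSubspace {
  csub_pred :> {pred V};
  csub_submod : submod_closed csub_pred;
  csub_closed : closed [set x | x \in csub_pred] }.

HB.instance Definition _ (S : closed_subspace) :=
  GRing.isSubmodClosed.Build K V (csub_pred S) (csub_submod S).

Variable S : closed_subspace.

Record csub := CSub { csub_val :> V; csub_valP : csub_val \in csub_pred S }.

HB.instance Definition _ := [isSub for csub_val].
HB.instance Definition _ := [Choice of csub by <:].
HB.instance Definition _ := [SubChoice_isSubLmodule of csub by <:].

Let csub_norm (x : csub) : K := `|csub_val x|.

Let csub_normD x y : csub_norm (x + y) <= csub_norm x + csub_norm y.
Proof. exact: ler_normD. Qed.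

Let csub_normZ a x : csub_norm (a *: x) = `|a| * csub_norm x.
Proof. exact: normrZ. Qed.

Let csub_norm0_eq0 x : csub_norm x = 0 -> x = 0.
Proof. by move/eqP; rewrite normr_eq0 => /eqP x0; apply: val_inj. Qed.

HB.instance Definition _ := Lmodule_isNormed.Build K csub
  csub_normD csub_normZ csub_norm0_eq0.

Lemma csub_complete (F : set_system csub) :
  ProperFilter F -> cauchy F -> cvg F.
Proof.
move=> FF FC.
have /cauchy_cvg/cvg_ex[l lF] : cauchy (csub_val @ F).
  by apply: contraction_cauchy.
have lS : l \in csub_pred S.
  apply: (@closed_cvg _ _ F _ csub_val [set x | x \in csub_pred S]) => //.
    exact: csub_closed.
  by apply: filterE => x; exact: csub_valP.
apply/cvg_ex; exists (CSub lS); apply/cvgrPdist_lt => e e0.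
by move/cvgrPdist_lt : lF => /(_ _ e0).
Qed.

HB.instance Definition _ := Uniform_isComplete.Build csub csub_complete.

End ClosedSubspaces.

(** * Operators and homogeneous polynomials *)

Section BoundedOperators.
Variables (R : realType) (k : scalar_kind).
Local Notation K := (scalar_field R k).
Implicit Types E F G : normedModType K.

(** The constant in [bounded_operator] may be 0, and on the trivial space it may be any scalar. A
    positive one can be divided by. *)
Lemma bounded_operator_pos E F (u : E -> F) : bounded_operator u ->
  exists2 M : K, 0 < M & forall x, `|u x| <= M * `|x|.
Proof.
move=> [_ [M uM]]; exists (`|M| + 1) => [|x]; first by rewrite ltr_wpDl.
have Mx0 : 0 <= M * `|x| by apply: le_trans (uM x).
apply: le_trans (uM x) _; rewrite -(ger0_norm Mx0) normrM normr_id.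
by rewrite ler_wpM2r// lerDl.
Qed.

Lemma bounded_operator_continuous E F (u : E -> F) :
  bounded_operator u -> continuous u.
Proof.
move=> ub x; have [uL _] := ub; have [M M0 uM] := bounded_operator_pos ub.
apply/cvgrPdist_lt => e e0.
have Me0 : 0 < M^-1 * e by rewrite mulr_gt0 ?invr_gt0.
apply: filterS (nbhsx_ballx x _ Me0) => y; rewrite -ball_normE /= => xy.
by rewrite -(linear_funB uL); apply: le_lt_trans (uM _) _; rewrite -ltr_pdivlMl.
Qed.

Lemma bounded_operator_contraction E F (u : E -> F) :
  linear u -> (forall x, `|u x| <= `|x|) -> bounded_operator u.
Proof. by move=> uL un; split => //; exists 1 => x; rewrite mul1r. Qed.

Lemma bounded_operator_comp E F G (v : F -> G) (u : E -> F) :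
  bounded_operator v -> bounded_operator u -> bounded_operator (v \o u).
Proof.
move=> vb ub; have [M M0 vM] := bounded_operator_pos vb.
have [N N0 uN] := bounded_operator_pos ub.
split; first by move=> a x y /=; rewrite ub.1 vb.1.
exists (M * N) => x /=; apply: le_trans (vM _) _.
by rewrite -mulrA ler_pM2l.
Qed.

Lemma bounded_operator_id E : bounded_operator (@id E).
Proof. exact: bounded_operator_contraction. Qed.

Lemma bounded_operator_linear_subspace E F :
  linear_subspace [set u : E -> F | bounded_operator u].
Proof.
split.
  by split=> [a x y|]; [rewrite scaler0 addr0|exists 0 => x; rewrite normr0 mul0r].
move=> a u v ub vb; have [M M0 uM] := bounded_operator_pos ub.
have [N N0 vN] := bounded_operator_pos vb; split.
  move=> b x y /=; rewrite ub.1 vb.1 !scalerDr !scalerA [a * b]mulrC.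
  by rewrite addrACA.
exists (`|a| * M + N) => x; apply: le_trans (ler_normD _ _) _.
by rewrite normrZ mulrDl -mulrA lerD// ler_wpM2l.
Qed.

Lemma bounded_operator_fst E F : bounded_operator (@fst E F).
Proof.
apply: bounded_operator_contraction => // x.
by rewrite prod_normE comparable_le_max ?real_comparable ?normr_real// lexx.
Qed.

Lemma bounded_operator_snd E F : bounded_operator (@snd E F).
Proof.
apply: bounded_operator_contraction => // x.
by rewrite prod_normE comparable_le_max ?real_comparable ?normr_real// lexx orbT.
Qed.

Lemma bounded_operator_csub_val (E : completeNormedModType K)
    (S : closed_subspace E) : bounded_operator (@csub_val _ _ S).
Proof. exact: bounded_operator_contraction. Qed.

Lemma bounded_operator_canonical_injection F :
  bounded_operator (@canonical_injection R k F).
Proof.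
apply: bounded_operator_contraction => [a x y|x].
  by apply/val_inj/funext => phi /=; rewrite (dual_fun_bounded_operator phi).1.
by apply: linfty_norm_le => // phi; exact: dual_ball_le.
Qed.

(* Operators out of [linfty] that have to extend a given one are of this form,
   so that the injectivity of [linfty] is never needed. *)
Lemma bounded_operator_linfty_pullback (S T : Type) (c : K) (tau : T -> S) :
  exists2 t : linfty R k S -> linfty R k T,
    bounded_operator t & forall f x, t f x = c * f (tau x).
Proof.
have tP (f : linfty R k S) : (fun x => c * f (tau x)) \in @linfty_pred R k T.
  have /asboolP[M fM] := linfty_funP f; apply/asboolP; exists (`|c| * M) => x.
  by rewrite normrM ler_wpM2l.
exists (fun f => Linfty (tP f)) => //; split.
  move=> a f g; apply/val_inj/funext => x /=.
  by rewrite mulrDr; congr (_ + _); exact: mulrCA.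
exists `|c| => f; apply: linfty_norm_le => [|x]; first by rewrite mulr_ge0.
by rewrite /= normrM ler_wpM2l// linfty_norm_ub.
Qed.

End BoundedOperators.

Section HomogeneousPolynomials.
Variables (R : realType) (k : scalar_kind).
Local Notation K := (scalar_field R k).
Implicit Types E F G : normedModType K.

Lemma homogeneous_polynomial_operator E F (u : E -> F) :
  bounded_operator u -> homogeneous_polynomial 1 u.
Proof.
move=> ub; split; last exact: bounded_operator_continuous.
exists (fun v => u (v ord0)); split => // v i; rewrite ord1 => a x y.
by rewrite !dfwithin ub.1.
Qed.

(** The [m * n] variables are arranged as a matrix by [mxvec_index]. [B] is applied to each row and
    [A] to the resulting [m] vectors. *)
Lemma homogeneous_polynomial_comp (m n : nat) E F G (P : F -> G) (Q : E -> F) :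
  homogeneous_polynomial m P -> homogeneous_polynomial n Q ->
  homogeneous_polynomial (m * n) (P \o Q).
Proof.
move=> [[A [AL PA]] Pc] [[B [BL QB]] Qc]; split; last first.
  by move=> x; apply: continuous_comp; [exact: Qc|exact: Pc].
exists (fun w => A (fun i => B (fun j => w (mxvec_index i j)))).
split=> [w p|x]; last by rewrite /= PA QB.
case/mxvec_indexP: p => i0 j0 /=.
(* Changing the variable at [(i0, j0)] changes only row [i0], and only its entry [j0], so linearity
   of [B] and then of [A] in one variable suffices. *)
have E0 x :
    (fun i => B (fun j => dfwith w (mxvec_index i0 j0) x (mxvec_index i j))) =
    dfwith (fun i => B (fun j => w (mxvec_index i j))) i0
      (B (dfwith (fun j => w (mxvec_index i0 j)) j0 x)).
  have idx i j i' j' : mxvec_index i j = mxvec_index i' j' :> 'I_(m * n) ->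
      i = i' /\ j = j'.
    by move/cast_ord_inj/enum_rank_inj => -[].
  apply/funext => i; have [->|ii0] := eqVneq i i0.
    rewrite dfwithin; congr B; apply/funext => j.
    have [->|jj0] := eqVneq j j0; first by rewrite !dfwithin.
    rewrite !dfwithout//; first by rewrite eq_sym.
    by apply: contra_neq jj0 => /idx[].
  rewrite dfwithout 1?eq_sym//; congr B; apply/funext => j.
  by rewrite dfwithout//; apply: contra_neq ii0 => /idx[].
by move=> a x y; rewrite !E0 BL AL.
Qed.

Lemma homogeneous_polynomial_pair (m : nat) E F G (P : E -> F) (Q : E -> G) :
  homogeneous_polynomial m P -> homogeneous_polynomial m Q ->
  homogeneous_polynomial m (fun x => (P x, Q x)).
Proof.
move=> [[A [AL PA]] Pc] [[B [BL QB]] Qc]; split; last first.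
  by move=> x; apply: cvg_pair; [exact: Pc|exact: Qc].
exists (fun v => (A v, B v)); split => [v i a x y|x]; last by rewrite PA QB.
by rewrite AL BL.
Qed.

Lemma homogeneous_polynomial_linear_subspace (m : nat) E F :
  linear_subspace [set P : E -> F | homogeneous_polynomial m P].
Proof.
split.
  split; last by move=> x; exact: cvg_cst.
  by exists (fun=> 0); split => // v i a x y; rewrite scaler0 addr0.
move=> a P Q [[A [AL PA]] Pc] [[B [BL QB]] Qc]; split; last first.
  move=> x; apply: cvgD; last exact: Qc.
  by apply: cvgZl_tmp; exact: Pc.
exists (fun v => a *: A v + B v); split => [v i b x y|x]; last by rewrite PA QB.
by rewrite AL BL !scalerDr !scalerA [a * b]mulrC addrACA.
Qed.

Lemma homogeneous_polynomial_power (m : nat) E (phi : E -> K^o) :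
  bounded_operator phi ->
  homogeneous_polynomial m (fun x => phi x ^+ m : K^o).
Proof.
move=> phib; split; last first.
  elim: m => [|m IH] x; first exact: cvg_cst.
  under eq_fun do rewrite exprS.
  by apply: cvgM; [exact: bounded_operator_continuous|exact: IH].
pose psi : E -> K := phi.
exists (fun v => \prod_(i < m) psi (v i)); split; last first.
  by move=> x; rewrite prodr_const card_ord.
move=> v i; pose c := \prod_(j < m | j != i) psi (v j).
have E0 z : \prod_(j < m) psi (dfwith v i z j) = psi z * c.
  rewrite (bigD1 i)// dfwithin; congr (_ * _).
  by apply: eq_bigr => j ji; rewrite dfwithout// eq_sym.
have psiL a x y : psi (a *: x + y) = a * psi x + psi y by exact: phib.1.
by move=> a x y; rewrite !E0 psiL mulrDl -mulrA.
Qed.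

(* The generating multilinear map need not be continuous, so it can be brought
   into the subspace by an arbitrary algebraic projection. *)
Lemma homogeneous_polynomial_csub (m : nat) E (F : completeNormedModType K)
    (S : closed_subspace F) (P : E -> F) (PS : forall x, P x \in csub_pred S) :
  homogeneous_polynomial m P ->
  homogeneous_polynomial m (fun x => CSub (PS x)).
Proof.
move=> [[A [AL PA]] Pc]; split; last first.
  move=> x; apply/cvgrPdist_lt => e e0.
  by have /cvgrPdist_lt/(_ _ e0) := Pc x.
have [p [pL pS pid]] := linear_projection (csub_submod S).
exists (fun v => CSub (pS (A v))); split => [v i a x y|x].
  by apply: val_inj; rewrite /= AL pL.
by apply: val_inj; rewrite /= -PA pid.
Qed.

End HomogeneousPolynomials.

(** * Ideals *)

Section Ideals.
Variables (R : realType) (k : scalar_kind).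
Local Notation K := (scalar_field R k).
Local Notation banach := (completeNormedModType K).
Implicit Types E F G H : banach.

Lemma finite_type_linear_subspace (m : nat) (E F : normedModType K)
    (S : set (E -> F)) (P : E -> F) :
  linear_subspace S ->
  (forall (phi : E -> K^o) (y : F), bounded_operator phi ->
     S (fun x => phi x ^+ m *: y)) ->
  finite_type m P -> S P.
Proof.
move=> [S0 SL] Sphi [n [phi [y [phib PE]]]].
have -> : P = fun x => \sum_(i < n) phi i x ^+ m *: y i by apply/funext.
elim: n phi y phib {PE} => [|n IH] phi y phib.
  by under eq_fun do rewrite big_ord0.
under eq_fun do rewrite big_ord_recl -[X in X + _]scale1r.
by apply: SL; [exact: Sphi|exact: IH].
Qed.

Section CompositionIdeal.
Variable I : operator_class R k.
Arguments I : clear implicits.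
Hypothesis hI : operator_ideal I.

Lemma operator_ideal_compl E F G (t : F -> G) (v : E -> F) :
  bounded_operator t -> I E F v -> I E G (t \o v).
Proof.
move=> tb Iv.
exact: (operator_ideal_comp hI tb Iv (@bounded_operator_id _ _ _)).
Qed.

Lemma operator_ideal_compr E F G (v : F -> G) (u : E -> F) :
  I F G v -> bounded_operator u -> I E G (v \o u).
Proof.
move=> Iv ub.
exact: (operator_ideal_comp hI (@bounded_operator_id _ _ _) Iv ub).
Qed.

Lemma composition_ideal_intro (m : nat) E F G (Q : E -> G) (u : G -> F) :
  homogeneous_polynomial m Q -> I G F u -> composition_ideal I m E F (u \o Q).
Proof.
move=> Qh Iu; split; last by exists G, Q, u.
rewrite -[m]mul1n; apply: homogeneous_polynomial_comp => //.
exact/homogeneous_polynomial_operator/(operator_ideal_sub hI Iu).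
Qed.

(** Two factorizations through [G] and [H] are merged into one through [G * H]: the polynomials are
    paired, and the operators are combined after the two projections. *)
Lemma composition_ideal_linear (m : nat) E F :
  linear_subspace (composition_ideal I m E F).
Proof.
have IL E' F' := operator_ideal_linear hI E' F'.
split.
  have [P0 _] := @homogeneous_polynomial_linear_subspace R k m E F.
  exact: (@composition_ideal_intro m E F F (fun=> 0) (fun=> 0) P0 (IL F F).1).
move=> a _ _ [_ [G [P [u [Ph Iu ->]]]]] [_ [H [Q [v [Qh Iv ->]]]]].
apply: (composition_ideal_intro (G := (G * H)%type)
  (u := fun z => a *: (u \o fst) z + (v \o snd) z)
  (homogeneous_polynomial_pair Ph Qh)).
apply: (IL _ _).2; apply: operator_ideal_compr => //.
  exact: bounded_operator_fst.
exact: bounded_operator_snd.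
Qed.

(* [linfty R k unit] plays the role of the scalar field as a Banach space. *)
Lemma composition_ideal_finite_type (m : nat) E F (P : E -> F) :
  finite_type m P -> composition_ideal I m E F P.
Proof.
apply: finite_type_linear_subspace; first exact: composition_ideal_linear.
move=> phi y phib.
have cP (c : K^o) : (fun _ : unit => c) \in @linfty_pred R k unit.
  by apply/asboolP; exists `|c|.
have cb : bounded_operator (fun c => Linfty (cP c)).
  apply: bounded_operator_contraction => [a c d|c]; first exact: val_inj.
  exact: linfty_norm_le.
(* A single term is the scalar polynomial [phi x ^+ m] followed by the operator of rank at most one
   that multiplies [y] by a scalar. *)
apply: (composition_ideal_intro (G := linfty R k unit)
  (Q := (fun c => Linfty (cP c)) \o (fun x => phi x ^+ m : K^o))
  (u := fun f => f tt *: y)).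
  rewrite -[m]mul1n; apply: homogeneous_polynomial_comp.
    exact: homogeneous_polynomial_operator.
  rewrite mul1n; exact: homogeneous_polynomial_power.
apply: (operator_ideal_finite_rank hI); split; last first.
  by exists 1%N, (fun=> y) => f; exists (fun=> f tt); rewrite big_ord1.
split=> [a f g|]; first by rewrite /= scalerDl scalerA.
exists `|y| => f; rewrite normrZ mulrC ler_wpM2l//.
exact: linfty_norm_ub.
Qed.

Lemma composition_ideal_hyper_comp (m n : nat) E F G H
    (t : G -> H) (P : F -> G) (P' : E -> F) :
  bounded_operator t -> composition_ideal I m F G P ->
  homogeneous_polynomial n P' ->
  composition_ideal I (m * n) E H (t \o P \o P').
Proof.
move=> tb [_ [G' [Q [u [Qh Iu ->]]]]] P'h.
apply: (@composition_ideal_intro _ _ _ _ (Q \o P') (t \o u)).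
  exact: homogeneous_polynomial_comp.
exact: operator_ideal_compl.
Qed.

Lemma composition_ideal_comp (m : nat) E F G H
    (t : G -> H) (P : F -> G) (u : E -> F) :
  bounded_operator t -> composition_ideal I m F G P -> bounded_operator u ->
  composition_ideal I m E H (t \o P \o u).
Proof.
move=> tb IP ub; rewrite -[m]muln1.
exact/composition_ideal_hyper_comp/homogeneous_polynomial_operator.
Qed.

Lemma composition_ideal_hyper_ideal :
  polynomial_hyper_ideal (composition_ideal I).
Proof.
split; last by move=> *; exact: composition_ideal_hyper_comp.
split.
- by move=> m E F P _ [].
- by move=> m E F _; exact: composition_ideal_linear.
- by move=> m E F P _; exact: composition_ideal_finite_type.
- by move=> *; exact: composition_ideal_comp.
Qed.

End CompositionIdeal.

(** * Canonical injections and injective hulls *)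

(** For [psi] in the dual ball of [G] and a positive bound [M] of [t], the functional [psi \o t]
    divided by [M] lies in the dual ball of [F]. Hence every coordinate of the image of [t y] is [M]
    times a coordinate of the image of [y]. This makes the hull stable under composition on the
    left. *)
Lemma canonical_injection_comp F G (t : F -> G) : bounded_operator t ->
  exists2 s : linfty R k (dual_ball F) -> linfty R k (dual_ball G),
    bounded_operator s &
    canonical_injection (F := G) \o t = s \o canonical_injection (F := F).
Proof.
move=> tb; have [M M0 tM] := bounded_operator_pos tb.
have tau (psi : dual_ball G) :
    exists phi : dual_ball F, forall y, psi (t y) = M * phi y.
  (* The summand 0 gives the functional the shape [a *: u x + v x] of [linear_subspace]. *)
  have b : bounded_operator (fun y => M^-1 *: psi (t y) + 0 : K^o).
    apply: (@bounded_operator_linear_subspace R k F K^o).2.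
      exact: (bounded_operator_comp (dual_fun_bounded_operator psi) tb).
    exact: (@bounded_operator_linear_subspace R k F K^o).1.
  have b1 y : `|y| <= 1 -> `|M^-1 *: psi (t y) + 0 : K^o| <= 1.
    move=> y1; rewrite addr0 normrZ normfV gtr0_norm// ler_pdivrMl// mulr1.
    apply: le_trans (dual_ball_le _ _) _; apply: le_trans (tM _) _.
    by rewrite ger_pMr.
  exists (DualBall b b1) => y /=; rewrite addr0 mulrA mulfV ?gt_eqF//.
  by rewrite mul1r.
have /choice[f fP] := tau.
have [s sb sE] := bounded_operator_linfty_pullback M f.
exists s => //; apply/funext => y; apply/val_inj/funext => psi.
by rewrite /= sE fP.
Qed.

(** The coordinate of [s] at [phi] reads off the coordinate at a chosen extension of [phi] along
    [j]. *)
Lemma canonical_injection_metric_injection F G (j : F -> G) :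
  metric_injection j ->
  exists2 s : linfty R k (dual_ball G) -> linfty R k (dual_ball F),
    bounded_operator s &
    s \o (canonical_injection (F := G) \o j) = canonical_injection (F := F).
Proof.
move=> jm.
have /choice[f fP] := fun phi : dual_ball F => dual_extension phi jm.
have [s sb sE] := @bounded_operator_linfty_pullback R k _ _ 1 f.
exists s => //; apply/funext => y; apply/val_inj/funext => psi.
by rewrite /= sE /= mul1r fP.
Qed.

(** Each property passes from [I] to the hull by linearity and boundedness of the canonical
    injection, except for composition on the left, where [t] has to be moved past the injection. *)
Lemma operator_injective_hull_ideal (I : operator_class R k) :
  operator_ideal I -> operator_ideal (operator_injective_hull I).
Proof.
move=> hI; have inj F := @bounded_operator_canonical_injection R k F.
split.
- by move=> E F u [].
- move=> E F; have [b0 bL] := @bounded_operator_linear_subspace R k E F.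
  have [I0 IL] := operator_ideal_linear hI E (linfty R k (dual_ball F)).
  split.
    split => //; rewrite [X in I _ _ X](_ : _ = fun=> 0)//.
    by apply/funext => x /=; rewrite (linear_fun0 (inj F).1).
  move=> a u v [ub Iu] [vb Iv]; split; first exact: bL.
  rewrite [X in I _ _ X](_ : _ = fun x =>
    a *: (canonical_injection (F := F) \o u) x +
    (canonical_injection (F := F) \o v) x); first exact: IL.
  by apply/funext => x /=; rewrite (inj F).1.
- move=> E F u [ub [n [y uy]]]; split => //.
  apply: (operator_ideal_finite_rank hI); split.
    exact: bounded_operator_comp.
  exists n, (fun i => canonical_injection (y i)) => x.
  have [c uE] := uy x; exists c; rewrite /= uE.
  have L := (inj F).1.
  elim/big_rec2: _ => [|i a b _ <-]; first exact: (linear_fun0 L).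
  by rewrite (linear_funD L) (linear_funZ L).
- move=> E F G H t v u tb [vb Iv] ub; split.
    by apply: bounded_operator_comp => //; exact: bounded_operator_comp.
  have [s sb sE] := canonical_injection_comp tb.
  rewrite [X in I _ _ X](_ : _ = s \o (canonical_injection (F := G) \o v) \o u).
    exact: (operator_ideal_comp hI).
  by apply/funext => x; exact: (congr1 (@^~ (v (u x))) sE).
Qed.

Lemma composition_ideal_injective_hull (I : operator_class R k) (m : nat) E F :
  operator_ideal I ->
  composition_ideal (operator_injective_hull I) m E F =
  polynomial_injective_hull (composition_ideal I) m E F.
Proof.
move=> hI; apply/seteqP; split => P.
  (* This inclusion is associativity: the canonical injection is absorbed into the operator. *)
  move=> [Ph [G [Q [u [Qh [ub Iu] PE]]]]]; split => //.
  by rewrite PE compA; exact: composition_ideal_intro.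
move=> [Ph [_ [G [Q [u [Qh Iu uQ]]]]]].
have ub := operator_ideal_sub hI Iu.
have injb := @bounded_operator_canonical_injection R k F.
(* The pullback is the kernel of the continuous linear map [d], hence a closed subspace. *)
pose d (z : G * F) := u z.1 - canonical_injection z.2.
pose D : {pred (G * F)%type} := fun z => d z == 0.
have dL : linear d.
  by move=> a x y; rewrite /d ub.1 injb.1 scalerBr opprD addrACA.
have DE z : (z \in D) = (d z == 0) by [].
have Dsub : submod_closed D.
  split; first by rewrite DE (linear_fun0 dL).
  move=> a x y; rewrite !DE => /eqP xD /eqP yD.
  by rewrite dL xD yD scaler0 addr0.
have dc : continuous d.
  move=> z; apply: cvgB.
    exact: (bounded_operator_continuous
      (bounded_operator_comp ub (@bounded_operator_fst R k G F))).
  exact: (bounded_operator_continuous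
    (bounded_operator_comp injb (@bounded_operator_snd R k G F))).
have Dclosed : closed [set z | z \in D].
  rewrite (_ : [set z | z \in D] = d @^-1` [set 0]).
    apply: preimage_closed => //.
    exact/accessible_closed_set1/hausdorff_accessible/norm_hausdorff.
  by apply/seteqP; split => z /=; rewrite DE => /eqP.
pose S := ClosedSubspace Dsub Dclosed.
have QPS x : (Q x, P x) \in csub_pred S.
  rewrite [_ \in _]DE /d /= subr_eq0; apply/eqP.
  by have := congr1 (@^~ x) uQ.
split => //.
exists (csub S), (fun x => CSub (QPS x)), (fun z => (csub_val z).2).
split => //.
  exact/homogeneous_polynomial_csub/homogeneous_polynomial_pair.
have valb := @bounded_operator_csub_val R k _ S.
split.
  exact: (bounded_operator_comp (@bounded_operator_snd R k G F) valb).
(* On the kernel of [d], the canonical injection of the second component is [u] of the first. *)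
rewrite (_ : _ \o _ = u \o (fst \o @csub_val _ _ S)).
  apply: operator_ideal_compr => //.
  exact: (bounded_operator_comp (@bounded_operator_fst R k G F) valb).
apply/funext => z /=; apply/esym/eqP; rewrite -subr_eq0.
exact: csub_valP z.
Qed.

End Ideals.

Theorem theorem3p5 (R : realType) (k : scalar_kind) (I : operator_class R k)
    (hI : operator_ideal I) :
  (forall (m : nat) (E F : completeNormedModType (scalar_field R k)),
     (0 < m)%N ->
     composition_ideal (operator_injective_hull I) m E F =
     polynomial_injective_hull (composition_ideal I) m E F) /\
  polynomial_hyper_ideal (composition_ideal (operator_injective_hull I)) /\
  injective_polynomial_class (composition_ideal (operator_injective_hull I)).
Proof.
split; first by move=> m E F _; exact: composition_ideal_injective_hull.
split; first exact/composition_ideal_hyper_ideal/operator_injective_hull_ideal.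
move=> m E F G P j _ Ph jm.
(* By the equality of classes, membership is tested after the canonical injections, and composing
   with [s] turns the test for [j \o P] into the test for [P]. *)
rewrite !composition_ideal_injective_hull// => -[_ IjP]; split => //.
have [s sb <-] := canonical_injection_metric_injection jm.
exact: (composition_ideal_comp hI sb IjP (@bounded_operator_id _ _ _)).
Qed.
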